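(* For each positive integer $n$, let $r(n)$ denote the number of cops needed to win the $1$-dimensional game of Rugby, played on $\mathbb{Z}\times[n]$ against a robber of speed $2$. Then $r(n)=\Omega(n^{0.03})$; that is, there exist a constant $c>0$ and an integer $n_0$ such that $r(n)\ge c\,n^{0.03}$ for all $n\ge n_0$.
   Context: Here $[n]=\{1,\dots,n\}$ and distance on $\mathbb{Z}\times[n]$ is the $l_\infty$ distance. The $1$-dimensional game of Rugby is a perfect information game on $\mathbb{Z}\times[n]$ between a finite team of cops and one robber (several cops may share a vertex). The cops first choose their initial positions. The robber then starts at $(-C,n)$, where $C$ is a very large integer, large enough that the robber's first coordinate is at least $2n$ less than the first coordinate of every cop. The two sides then move alternately forever, the cops going first: on the cops' turn each cop moves to a vertex at distance at most $1$ (possibly staying put), and on the robber's turn he moves to a vertex at distance at most $2$ (possibly staying put). The robber wins if, for every positive integer $k$, he at some time passes the line $\{k\}\times[n]$ (i.e. his first coordinate exceeds $k$), without any cop ever being at the same vertex as him; otherwise the cops win. The number of cops needed to win is the minimum $m$ such that $m$ cops can choose initial positions and have a strategy preventing the robber from winning, for every admissible $C$. *)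

(* Defs.v *)
From mathcomp Require Import all_boot all_order all_algebra.
From mathcomp Require Import boolp reals exp.
From mathcomp Require Import zify.

Set Implicit Arguments.
Unset Strict Implicit.
Unset Printing Implicit Defensive.

Import Order.TTheory GRing.Theory Num.Theory.
Local Open Scope ring_scope.

(* The rows are numbered from 0: row j of [n] = {1, ..., n} is the ordinal
   j - 1, so the starting row n of the robber is the j : 'I_n with j.+1 = n. *)
Definition vertex (n : nat) : Type := (int * 'I_n)%type.

Definition linf_dist n (u v : vertex n) : nat :=
  maxn `|u.1 - v.1|%N `|(u.2 : int) - (v.2 : int)|%N.

Definition cops (n m : nat) : Type := {ffun 'I_m -> vertex n}.

Definition state (n m : nat) : Type := (cops n m * vertex n)%type.

(* Perfect information: the next positions of the cops may depend on all the
   states of the game so far, the current one being the last of the list. *)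
Definition cop_strategy (n m : nat) : Type := seq (state n m) -> cops n m.

Definition legal_strategy n m (sigma : cop_strategy n m) : Prop :=
  forall (h : seq (state n m)) (s : state n m) (i : 'I_m),
    (linf_dist (s.1 i) (sigma (rcons h s) i) <= 1)%N.

(* The cops move first: c t and r t are the positions after t moves of each
   side, and between r t and r t.+1 the cops are at c t.+1. *)
Definition history n m (c : nat -> cops n m) (r : nat -> vertex n) (t : nat) :
    seq (state n m) :=
  [seq (c s, r s) | s <- iota 0 t.+1].

Definition follows n m (sigma : cop_strategy n m) (p : cops n m)
    (c : nat -> cops n m) (r : nat -> vertex n) : Prop :=
  c 0%N = p /\ forall t, c t.+1 = sigma (history c r t).

Definition robber_path n (C : int) (r : nat -> vertex n) : Prop :=
  [/\ (r 0%N).1 = - C, (r 0%N).2.+1 = n &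
      forall t, (linf_dist (r t) (r t.+1) <= 2)%N].

Definition captured n m (c : nat -> cops n m) (r : nat -> vertex n) : Prop :=
  exists (t : nat) (i : 'I_m), c t i = r t \/ c t.+1 i = r t.

Definition robber_wins n m (c : nat -> cops n m) (r : nat -> vertex n) : Prop :=
  (forall k : nat, (0 < k)%N -> exists t, k%:Z < (r t).1) /\ ~ captured c r.

Definition admissible n m (p : cops n m) (C : int) : Prop :=
  forall i, - C + (2 * n)%N%:Z <= (p i).1.

Definition cops_win (n m : nat) : Prop :=
  exists (p : cops n m) (sigma : cop_strategy n m),
    legal_strategy sigma /\
    forall (C : int) (c : nat -> cops n m) (r : nat -> vertex n),
      admissible p C -> robber_path C r -> follows sigma p c r ->
      ~ robber_wins c r.

(* Two full columns of motionless cops cannot be crossed at speed 2. *)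
Lemma half_ltn n (i : 'I_(2 * n)) : (i./2 < n)%N.
Proof. by have := ltn_ord i; lia. Qed.

Lemma double_ltn n (j : 'I_n) (b : bool) : (b + j.*2 < 2 * n)%N.
Proof. by have := ltn_ord j; case: b; lia. Qed.

Lemma last_iota1 t : last 0%N (iota 1 t) = t.
Proof. by case: t => // t; rewrite -nth_last size_iota nth_iota. Qed.

Lemma cops_win_double n : cops_win n (2 * n).
Proof.
pose p : cops n (2 * n) := [ffun i : 'I_(2 * n) => ((odd i : nat)%:Z, Ordinal (half_ltn i))].
pose sigma (h : seq (state n (2 * n))) := if h is s :: h' then (last s h').1 else p.
exists p, sigma; split=> [h s i|C c r adm [r0 r0n rS] [c0 cS] [win ncap]].
  have -> : sigma (rcons h s) = s.1 by case: h => //= s' h; rewrite last_rcons.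
  by rewrite /linf_dist !subrr.
have cp t : c t = p.
  elim: t => // t IH; rewrite cS /sigma /history -[RHS]IH /=.
  rewrite (last_map (fun s => (c s, r s)) _ 0%N) /=; congr c.
  exact: last_iota1.
have blocked (j : 'I_n) (b : bool) : p (Ordinal (double_ltn j b)) = ((b : nat)%:Z, j).
  rewrite ffunE /= oddD odd_double addbF oddb; congr pair.
  by apply: val_inj; rewrite /= half_bit_double.
have neg t : (r t).1 < 0.
  elim: t => [|t IH].
    have := adm (Ordinal (double_ltn (r 0%N).2 false)).
    by rewrite blocked r0 /=; have := ltn_ord (r 0%N).2; lia.
  have := rS t; rewrite /linf_dist geq_max => /andP[d1 _].
  rewrite ltNge; apply/negP => ge0; apply: ncap.
  have [b rb] : exists b : bool, (r t.+1).1 = (b : nat)%:Z.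
    have [->|->] : (r t.+1).1 = 0 \/ (r t.+1).1 = 1 by lia.
      by exists false.
    by exists true.
  exists t.+1, (Ordinal (double_ltn (r t.+1).2 b)); left.
  by rewrite cp blocked -rb -surjective_pairing.
by have [t] := win 1%N isT; have := neg t; lia.
Qed.

Lemma cops_win_exists n : exists m, `[< cops_win n m >].
Proof. by exists (2 * n)%N; apply/asboolP/cops_win_double. Qed.

(* Only meaningful for 0 < n: on the empty board the value is 0. *)
Definition cop_number (n : nat) : nat := ex_minn (cops_win_exists n).

(* Main.v *)
Require Import Defs.
From mathcomp Require Import all_boot all_order all_algebra.
From mathcomp Require Import boolp reals exp.
From mathcomp Require Import zify.

Set Implicit Arguments.
Unset Strict Implicit.
Unset Printing Implicit Defensive.

Import Order.TTheory GRing.Theory Num.Theory.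
Local Open Scope ring_scope.

(** Fewer than [2 ^ j] cops cannot guard a strip of width about [1024 ^ j], so
    the number of cops grows at least like [n ^ (1 / 10)].

    The robber advances by two columns at every move, and in the same move goes
    up or down by two rows.  A cop then loses between one and three columns on
    the robber at each move: once behind him it never returns, and it meets him,
    if at all, during one short window.  A path of the robber is a list of
    up/down choices, and against a known strategy the cops' positions are
    functions of that path.

    The proof shows, by induction on the scale [j], that a robber with fewer
    than [2 ^ j] cops in a box of radius [10 * 1024 ^ j] around him, and fewer
    than [2 ^ i] in radius [100 * 1024 ^ i] for every smaller [i], can go about
    [1024 ^ j] steps in any prescribed vertical direction and keep the
    lower-scale bounds ([traversable]).  He chains flights of scale [j - 1] in
    that direction for as long as the bound of scale [j - 1] holds.  When a
    crowd of at least [2 ^ (j - 1)] cops appears within radius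
    [100 * 1024 ^ (j - 1)], he makes a [detour]: he flees up or down until all
    the cops of this crowd are behind him.  He can do so because the set of cops
    able to disturb the flight up and the set able to disturb the flight down
    are disjoint: going up at speed nearly 2, after a while he is out of reach
    of every cop that started below him, since cops have speed 1.  One of the
    two sets has fewer than [2 ^ (j - 1)] cops, and on that side flights of
    scale [j - 1] succeed.

    The delicate point is that detours may be in the wrong direction, and that
    they occur at all scales.  The time lost is charged to the cops: a detour of
    scale [i] costs a constant times [1024 ^ i], but it leaves at least [2 ^ i]
    cops behind for good, so each of them pays about [512 ^ i].  Cops are
    overtaken once only and the rates [512 ^ i] increase geometrically, so at
    scale [j] the total loss is at most [512 ^ j] per overtaken cop.  Fewer than
    [2 ^ j] cops thus cost less than [1024 ^ j] rows, and the net vertical speed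
    stays large; in particular the flights used inside a detour are fast enough for
    the disjointness argument.

    At the top scale all the cops together number fewer than [2 ^ j], so the
    robber can repeat this for ever, alternating directions to remain inside the
    strip ([roam]), until all the cops are behind. *)

(** * Paths of the robber *)

(** A path lists the vertical choices of the robber, the latest first: [true]
    is two rows up, [false] two rows down.  The number [disp b k] is the net
    displacement of [k] counted positively in the direction [b]. *)
Fixpoint disp (b : bool) (k : seq bool) : int :=
  if k is a :: k' then disp b k' + (if a == b then 2 else -2) else 0.

Lemma disp_cat b k k' : disp b (k' ++ k) = disp b k' + disp b k.
Proof. by elim: k' => [|a k' IH] /=; [rewrite add0r | rewrite IH addrAC]. Qed.

Lemma dispN b k : disp (~~ b) k = - disp b k.
Proof.
elim: k => [|a k IH] /=; first by rewrite oppr0.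
by rewrite IH; case: a; case: b {IH} => /=; lia.
Qed.

Lemma disp_bound b k : `|disp b k| <= (2 * size k)%N%:Z.
Proof. by elim: k => [|a k IH] //=; case: ifP; lia. Qed.

Lemma iterate_until (Inv : seq bool -> Prop) (q t : nat) :
  Inv [::] ->
  (forall k, Inv k -> (size k < t)%N ->
    exists k', [/\ (0 < size k')%N, (size k' <= q)%N & Inv (k' ++ k)]) ->
  exists k, [/\ (t <= size k)%N, (size k <= t + q)%N & Inv k].
Proof.
move=> Inv0 step.
suff reach d k : Inv k -> (size k <= t + q)%N -> (t - size k <= d)%N ->
    exists k1, [/\ (t <= size k1)%N, (size k1 <= t + q)%N & Inv k1].
  by apply: (reach t [::]); rewrite ?leq_subr.
elim: d k => [|d IH] k Ik kq kd; first by exists k; split=> //; lia.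
have [tk|kt] := leqP t (size k); first by exists k.
have [k' [k'0 k'q Ik']] := step k Ik kt.
by apply: (IH _ Ik'); rewrite size_cat; lia.
Qed.

(** * The chase in the frame of the robber *)

(** The numbers [dx c l] and [dy c l] are the coordinates of the cop [c]
    relative to the robber after the path [l].  The two hypotheses are all that
    is used of the rules: the robber moves by (2, 2) or (2, -2), the cop by at
    most 1 in each coordinate. *)
Section Chase.

Variables (cop : finType) (dx dy : cop -> seq bool -> int).
Hypothesis dx_step : forall c b l, dx c l - 3 <= dx c (b :: l) <= dx c l - 1.
Hypothesis dy_step : forall c b l,
  `|dy c (b :: l) - dy c l + (if b then 2 else -2)| <= 1.

Lemma dx_cat c k l :
  dx c l - (3 * size k)%N%:Z <= dx c (k ++ l) <= dx c l - (size k)%:Z.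
Proof. by elim: k => [|b k IH] /=; [lia | have := dx_step c b (k ++ l); lia]. Qed.

Definition height (b : bool) c l : int := if b then dy c l else - dy c l.

Lemma height_cat b c k l :
  `|height b c (k ++ l) - height b c l + disp b k| <= (size k)%:Z.
Proof.
elim: k => [|a k IH] /=; first by lia.
have := dy_step c a (k ++ l); move: IH; rewrite /height.
by case: a b => -[] /=; lia.
Qed.

(** The bound is -1, not 0, so that a cop which is not [ahead] is more than one
    column behind, out of reach whatever its next move. *)
Definition ahead l c : bool := -1 <= dx c l.
Definition near (r : nat) l c : bool :=
  [&& ahead l c, dx c l <= r%:Z & `|dy c l| <= r%:Z].

Lemma ahead_cat k l c : ahead (k ++ l) c -> ahead l c.
Proof. by rewrite /ahead; have := dx_cat c k l; lia. Qed.

Lemma near_cat r k l c : near r (k ++ l) c -> near (r + 3 * size k) l c.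
Proof.
move=> /and3P[ah rx ry]; rewrite /near (ahead_cat ah).
have := dx_cat c k l; have := height_cat true c k l; have := disp_bound true k.
by rewrite /height; lia.
Qed.

Lemma near_le r s l c : (r <= s)%N -> near r l c -> near s l c.
Proof. by move=> rs /and3P[ah rx ry]; apply/and3P; split=> //; lia. Qed.

Definition crowd r l : {set cop} := [set c | near r l c].
Definition left_in (V : {set cop}) l : nat := #|[set c in V | ahead l c]|.

Lemma left_in_cat V k l : (left_in V (k ++ l) <= left_in V l)%N.
Proof.
apply: subset_leq_card; apply/subsetP=> c; rewrite !inE => /andP[-> /=].
exact: ahead_cat.
Qed.

(** A flight overtakes at least as many cops of a larger set: this converts a
    loss charged to the cops near the start of a short flight into a loss
    charged to those near the start of the longer flight that contains it. *)
Lemma left_in_sub {V W : {set cop}} k l : V \subset W ->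
  (left_in V l + left_in W (k ++ l) <= left_in W l + left_in V (k ++ l))%N.
Proof.
move=> sVW.
have split_left l' : left_in W l' = (left_in V l' + left_in (W :\: V) l')%N.
  rewrite /left_in -(cardsID V); congr (_ + _)%N; apply: eq_card => c.
    by rewrite !inE; have /subsetP/(_ c) := sVW; case: (c \in V) => [->|_] //;
      rewrite ?andbF ?andbT.
  by rewrite !inE andbA.
by rewrite !split_left; have := left_in_cat (W :\: V) k l; lia.
Qed.

Fixpoint clear l : bool :=
  (crowd 1 l == set0) && (if l is _ :: l' then clear l' else true).

(** The radius is ten times the one that a flight of scale [i] needs to be clear
    of a crowd.  The margin leaves the robber time to make a detour when he sees
    this bound fail. *)
Definition good j l : Prop := forall i, (i < j)%N -> (#|crowd (100 * 1024 ^ i) l| < 2 ^ i)%N.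

(** The last inequality says that the flight gains [2 * size k] rows in the
    direction [b], up to a loss of [512 ^ j] for each cop overtaken. *)
Definition traversable j : Prop := forall l b,
  (#|crowd (10 * 1024 ^ j) l| < 2 ^ j)%N -> good j l -> clear l ->
  exists k, [/\ (1024 ^ j <= size k)%N, (size k <= 2 * 1024 ^ j)%N,
    good j (k ++ l), clear (k ++ l) &
    (2 * size k + 512 ^ j * left_in (crowd (10 * 1024 ^ j) l) (k ++ l))%N%:Z
    <= disp b k + (512 ^ j * left_in (crowd (10 * 1024 ^ j) l) l)%N%:Z].

Lemma traversable0 : traversable 0.
Proof.
move=> l b; rewrite expn0 ltnS leqn0 cards_eq0 => /eqP none _ cl.
have empty r : (r <= 7)%N -> crowd r (b :: l) = set0.
  move=> r7; apply/setP=> c; rewrite !inE; apply/negP => /(@near_cat _ [:: b]) nr.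
  have /setP/(_ c) := none; rewrite !inE.
  by rewrite (near_le _ nr) //=; lia.
exists [:: b]; split => //=.
  by rewrite empty // eqxx.
rewrite eqxx !expn0 !mul1n /left_in none.
by rewrite !(eq_card0 (A := [set _ in _ | _])) // => c; rewrite !inE.
Qed.

(** * From one scale to the next *)

Section Step.
Variables (j : nat) (V : {set cop}).
Hypothesis trav : traversable j.
Let S := (1024 ^ j)%N.
Let a := (512 ^ j)%N.
Let h := (2 ^ j)%N.

Lemma traverse_in l b : crowd (10 * S) l \subset V ->
  (#|crowd (10 * S) l| < h)%N -> good j l -> clear l ->
  exists k, [/\ (S <= size k)%N, (size k <= 2 * S)%N,
    good j (k ++ l), clear (k ++ l) &
    (2 * size k + a * left_in V (k ++ l))%N%:Z
    <= disp b k + (a * left_in V l)%N%:Z].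
Proof.
move=> sV few gl cl; have [k [Sk kS gk ck gain]] := @trav l b few gl cl.
exists k; split=> //.
have : (a * left_in (crowd (10 * S) l) l + a * left_in V (k ++ l) <=
        a * left_in V l + a * left_in (crowd (10 * S) l) (k ++ l))%N.
  by rewrite -!mulnDr leq_mul2l left_in_sub // orbT.
by move: gain; rewrite -/S -/a; lia.
Qed.

Lemma S_gt0 : (0 < S)%N. Proof. by rewrite expn_gt0. Qed.

Lemma ahS : (a * h = S)%N.
Proof. by rewrite /a /h -expnMn. Qed.

(** A cop cannot be both above and below the robber, so one of the two sides
    has fewer than half of the cops. *)
Lemma thin_side l : (left_in V l < 2 * h)%N ->
  exists b, (#|[set c in V | ahead l c & (0 < height b c l)%R]| < h)%N.
Proof.
move=> fewV.
pose side b := [set c in V | ahead l c & (0 < height b c l)%R].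
have : (#|side true| + #|side false| <= left_in V l)%N.
  rewrite -cardsUI (_ : side true :&: side false = set0) ?cards0 ?addn0.
    apply: subset_leq_card; apply/subsetP=> c; rewrite !inE.
    by case/orP=> /and3P[-> ->].
  apply/setP=> c; rewrite !inE /height; apply/negP.
  by case/andP=> /and3P[_ _ up] /and3P[_ _ down]; lia.
have [ltu|leu] := ltnP #|side true| h; first by exists true.
by exists false; move: leu; rewrite -/(side false); lia.
Qed.

(** The robber flees to the side [b] with fewer than [h] cops.  The cops that
    come within [10 * S] of him in the first [13 * S] steps were among the fewer
    than [h] cops within [94 * S] at the beginning.  Later he has moved more
    than [2 * t - 2 * S] rows in [t] steps, whereas a cop moves [t] at most:
    the cops that come close were on the side [b] of him at the beginning.  After
    [100 * S + 2] steps the crowd is behind him, and too few cops remain to form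
    another one. *)
Lemma detour l : (left_in V l < 2 * h)%N ->
  (forall k, (size k <= 100 * S + 2 + 2 * S)%N -> crowd (100 * S) (k ++ l) \subset V) ->
  (#|crowd (94 * S) l| < h)%N -> (h <= #|crowd (100 * S) l|)%N ->
  good j l -> clear l ->
  exists k, [/\ (0 < size k)%N, (size k <= 104 * S)%N, good j.+1 (k ++ l),
    clear (k ++ l) & (left_in V (k ++ l) + h <= left_in V l)%N].
Proof.
move=> fewV inV few94 many gl cl; have S0 := S_gt0.
have [b thin] := thin_side fewV.
pose Inv k := [/\ good j (k ++ l), clear (k ++ l) &
  (2 * size k + a * left_in V (k ++ l))%N%:Z <= disp b k + (a * left_in V l)%N%:Z].
have [] := @iterate_until Inv (2 * S) (100 * S + 2).
- by split.
- move=> k [gk ck gain] kt.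
  have few : (#|crowd (10 * S) (k ++ l)| < h)%N.
    have [early|late] := leqP (size k) (13 * S).
      apply: leq_ltn_trans few94; apply: subset_leq_card.
      apply/subsetP=> c; rewrite !inE => /near_cat; apply: near_le; lia.
    apply: leq_ltn_trans thin; apply: subset_leq_card.
    apply/subsetP=> c nc; rewrite inE.
    have -> : c \in V.
      have /subsetP := inV k (ltac:(lia)); apply.
      by move: nc; rewrite !inE; apply: near_le; lia.
    move: nc; rewrite inE => /and3P[/ahead_cat -> _ ry] /=.
    (* The total loss is less than a * (2 * h) = 2 * S. *)
    have : (a * left_in V l < a * (2 * h))%N.
      by rewrite ltn_pmul2l // expn_gt0.
    rewrite mulnCA ahS.
    have := height_cat b c k l.
    have : `|height b c (k ++ l)| <= (10 * S)%N by rewrite /height; case: (b); lia.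
    by lia.
  have sub : crowd (10 * S) (k ++ l) \subset V.
    apply: subset_trans (inV k _); last by lia.
    by apply/subsetP=> c; rewrite !inE; apply: near_le; lia.
  have [k' [Sk' k'S gk' ck' gain']] := traverse_in b sub few gk ck.
  exists k'; rewrite /Inv -!catA; split; [lia|lia|split=> //].
  by rewrite disp_cat size_cat; lia.
- move=> k [tk kt [gk ck _]].
have passed : (left_in V (k ++ l) + h <= left_in V l)%N.
  have -> : left_in V l = (left_in (crowd (100 * S) l) l
      + left_in (V :\: crowd (100 * S) l) l)%N.
    rewrite /left_in -(cardsID (crowd (100 * S) l)); congr (_ + _)%N; apply: eq_card => c.
      rewrite !inE; have /subsetP/(_ c) := inV [::] isT; rewrite !inE /=.
      by case: near => [->|_] //; rewrite ?andbF ?andbT.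
    by rewrite !inE andbA.
  rewrite addnC leq_add //.
    apply: leq_trans many _; apply: subset_leq_card; apply/subsetP=> c.
    by rewrite !inE => nc; rewrite nc; case/and3P: nc.
  apply: leq_trans (left_in_cat _ k l); apply: subset_leq_card; apply/subsetP=> c.
  rewrite !inE => /andP[-> ak]; rewrite ak !andbT; apply/negP => /and3P[_ rx _].
  by move: ak; rewrite /ahead; have := dx_cat c k l; lia.
exists k; split=> //; try lia.
move=> i; rewrite ltnS leq_eqVlt => /orP[/eqP->|]; last exact: gk.
have leV : (#|crowd (100 * S) (k ++ l)| <= left_in V (k ++ l))%N.
  apply: subset_leq_card; apply/subsetP=> c nc; rewrite inE.
  have /subsetP/(_ c nc) -> /= := inV k (ltac:(lia)).
  by move: nc; rewrite inE => /and3P[].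
by rewrite -/S -/h; lia.
Qed.

End Step.

(** A flight of at most [2 * S] steps brings no cop from beyond [100 * S] to
    within [94 * S], so a new crowd is seen in time for a detour.  A detour
    takes at most [104 * S] steps, hence costs at most [416 * S] rows compared
    with moving straight in the direction [b], while the [h] cops that it
    overtakes pay [512 * a * h = 512 * S]. *)
Lemma traversable_succ j : traversable j -> traversable j.+1.
Proof.
move=> trav l b few gl cl.
set V := crowd _ l in few *.
pose S := (1024 ^ j)%N; pose a := (512 ^ j)%N; pose h := (2 ^ j)%N.
have S0 : (0 < S)%N by rewrite expn_gt0.
have ahS : (a * h = S)%N by exact: ahS.
have few2 k : (left_in V (k ++ l) < 2 * h)%N.
  rewrite -expnS; apply: leq_ltn_trans few; apply: leq_trans (left_in_cat _ k l) _.
  by apply: subset_leq_card; apply/subsetP=> c; rewrite inE => /andP[].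
have inV k : (size k <= 2048 * S)%N -> crowd (100 * S) (k ++ l) \subset V.
  move=> kS; apply/subsetP=> c; rewrite !inE => /near_cat; apply: near_le.
  by rewrite expnS -/S; lia.
pose Inv k := [/\ good j.+1 (k ++ l), clear (k ++ l) &
  (2 * size k + 512 * a * left_in V (k ++ l))%N%:Z
  <= disp b k + (512 * a * left_in V l)%N%:Z].
have [] := @iterate_until Inv (106 * S) (1024 * S).
- by split.
- move=> k [gk ck gain] kt.
  have fewk := gk j (leqnn _).
  have gjk : good j (k ++ l) by move=> i ij; apply: gk; lia.
  have sub : crowd (10 * S) (k ++ l) \subset V.
    apply: subset_trans (inV k _); last by lia.
    by apply/subsetP=> c; rewrite !inE; apply: near_le; lia.
  have few10 : (#|crowd (10 * S) (k ++ l)| < h)%N.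
    apply: leq_ltn_trans fewk; apply: subset_leq_card.
    by apply/subsetP=> c; rewrite !inE; apply: near_le; rewrite -/S; lia.
  have [k1 [Sk1 k1S gk1 ck1 gain1]] := traverse_in trav b sub few10 gjk ck.
  have mono := left_in_cat V k1 (k ++ l).
  have gain1' : (2 * size k1 + 512 * a * left_in V (k1 ++ k ++ l))%N%:Z
      <= disp b k1 + (512 * a * left_in V (k ++ l))%N%:Z.
    have : (511 * a * left_in V (k1 ++ k ++ l) <= 511 * a * left_in V (k ++ l))%N.
      by rewrite leq_mul2l mono orbT.
    by move: gain1; rewrite -/S -/a; lia.
  have [many|fewer] := leqP h #|crowd (100 * S) (k1 ++ k ++ l)|; last first.
    exists k1; rewrite /Inv -!catA; split; [lia|lia|split=> //].
      by move=> i; rewrite ltnS leq_eqVlt => /orP[/eqP->|] //; exact: gk1.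
    by rewrite disp_cat size_cat; lia.
  have [] := @detour _ V trav (k1 ++ k ++ l) _ _ _ many gk1 ck1.
  + by rewrite catA; exact: few2.
  + move=> k2 k2S; rewrite !catA; apply: inV; rewrite !size_cat.
    by rewrite -/S in k2S kt Sk1 k1S; lia.
  + apply: leq_ltn_trans fewk; apply: subset_leq_card.
    by apply/subsetP=> c; rewrite !inE => /near_cat; apply: near_le; rewrite -/S; lia.
  move=> k2 [k20 k2S gk2 ck2 passed].
  exists (k2 ++ k1); rewrite /Inv -!catA; rewrite -/S in k2S k1S.
  split; rewrite ?size_cat; [lia|lia|split=> //].
  have : (512 * a * (left_in V (k2 ++ k1 ++ k ++ l) + h)
      <= 512 * a * left_in V (k1 ++ k ++ l))%N.
    by rewrite leq_mul2l passed orbT.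
  rewrite mulnDr -[(_ * h)%N]mulnA ahS.
  have := disp_bound b k2.
  by rewrite !disp_cat ?size_cat; lia.
move=> k [tk kt [gk ck gain]].
by exists k; rewrite !expnS -/S -/a; split=> //; lia.
Qed.

Lemma traversable_all j : traversable j.
Proof. elim: j => [|j]; [exact: traversable0 | exact: traversable_succ]. Qed.


Lemma clear_drop t l : clear l -> crowd 1 (drop t l) = set0.
Proof.
elim: l t => [|b l IH] [|t] /=; try by [move=> /andP[/eqP]].
by case/andP=> _; exact: IH.
Qed.

(** With fewer than [2 ^ j] cops in all, a flight of scale [j] has a positive
    net displacement in the chosen direction: flying always towards the starting
    row keeps the robber in a band around it. *)
Lemma roam j T l : (#|cop| < 2 ^ j)%N -> good j l -> clear l ->
  exists k, [/\ (T <= size k)%N, clear (k ++ l) &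
    forall t, `|disp true (drop t k)| <= (8 * 1024 ^ j)%N%:Z].
Proof.
move=> few gl cl; pose S := (1024 ^ j)%N.
pose Inv k := [/\ good j (k ++ l), clear (k ++ l),
  forall t, `|disp true (drop t k)| <= (8 * S)%N%:Z & `|disp true k| <= (4 * S)%N%:Z].
have [] := @iterate_until Inv (2 * S) T.
- by split=> //=.
- move=> k [gk ck band mid] _.
  have fewj r l' : (#|crowd r l'| < 2 ^ j)%N by apply: leq_ltn_trans few; exact: max_card.
  have [k' [Sk' k'S gk' ck' gain]] :=
    @traversable_all j (k ++ l) (disp true k < 0) (fewj _ _) gk ck.
  have S0 : (0 < S)%N by rewrite expn_gt0.
  have pos : 0 < disp (disp true k < 0) k'.
    have : (512 ^ j * left_in (crowd (10 * 1024 ^ j) (k ++ l)) (k ++ l) < 1024 ^ j)%N.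
      rewrite [X in (_ < X)%N](expnMn 512 2) ltn_pmul2l ?expn_gt0 //.
      apply: leq_ltn_trans (fewj (10 * 1024 ^ j)%N (k ++ l)).
      by apply: subset_leq_card; apply/subsetP=> c; rewrite inE => /andP[].
    by rewrite -/S in gain Sk' *; lia.
  have bound := disp_bound true k'.
  exists k'; rewrite /Inv -!catA; split; [rewrite -/S in Sk'; lia|exact: k'S|split=> //].
    move=> t; rewrite drop_cat; case: ifP => _; last exact: band.
    rewrite disp_cat; have := disp_bound true (drop t k'); rewrite size_drop.
    by rewrite -/S in k'S; lia.
  rewrite disp_cat; move: pos; have [neg|nneg] := ltP (disp true k) 0.
    by rewrite -/S in k'S; lia.
  by rewrite (dispN true); rewrite -/S in k'S; lia.
by move=> k [Tk _ [_ ck band _]]; exists k.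
Qed.

End Chase.


(** * Playing a path against a strategy *)

Section Pursuit.

Variables (n' m : nat).
Let n := n'.+1.
Variables (p : cops n m) (sigma : cop_strategy n m) (C : int).
Hypothesis legal : legal_strategy sigma.

(** The row as an integer, before it is known to lie in the board; [runner]
    truncates it, so that the answer of the cops is defined for every path. *)
Definition row l : int := n'%:Z + disp true l.
Definition runner l : vertex n := (- C + (2 * size l)%N%:Z, inord `|row l|%N).

Fixpoint record l : seq (state n m) :=
  if l is _ :: l' then rcons (record l') (sigma (record l'), runner l)
  else [:: (p, runner [::])].
Definition chasers l : cops n m := if l is _ :: l' then sigma (record l') else p.

Lemma recordE l : exists h, record l = rcons h (chasers l, runner l).
Proof. by case: l => [|b l]; [exists [::] | exists (record l)]. Qed.

Lemma chasers_step b l i : (linf_dist (chasers l i) (chasers (b :: l) i) <= 1)%N.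
Proof. by have [h /= ->] := recordE l; exact: (legal h (chasers l, runner l)). Qed.

Definition gap_x (i : 'I_m) l : int := (chasers l i).1 - (runner l).1.
Definition gap_y (i : 'I_m) l : int := ((chasers l i).2 : nat)%:Z - row l.

Lemma gap_x_step i b l : gap_x i l - 3 <= gap_x i (b :: l) <= gap_x i l - 1.
Proof.
by have := chasers_step b l i; rewrite /linf_dist /gap_x geq_max /= => /andP[]; lia.
Qed.

Lemma gap_y_step i b l :
  `|gap_y i (b :: l) - gap_y i l + (if b then 2 else -2)| <= 1.
Proof.
have := chasers_step b l i; rewrite /linf_dist /gap_y /row geq_max => /andP[_].
by case: b => /=; lia.
Qed.

Lemma runner_row l : 0 <= row l <= n'%:Z -> ((runner l).2 : nat)%:Z = row l.
Proof. by move=> rl; rewrite /= inordK; lia. Qed.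

Section Play.
Variable l : seq bool.

(** The infinite path that follows [l], then runs along a row. *)
Definition route t : vertex n :=
  (- C + (2 * t)%N%:Z, (runner (drop (size l - t) l)).2).

Lemma route_runner t : (t <= size l)%N -> route t = runner (drop (size l - t) l).
Proof. by move=> tl; rewrite /route /runner size_drop subKn. Qed.

Fixpoint transcript t : seq (state n m) :=
  if t is t'.+1 then rcons (transcript t') (sigma (transcript t'), route t)
  else [:: (p, route 0)].
Definition response t : cops n m :=
  if t is t'.+1 then sigma (transcript t') else p.

Lemma transcriptE t : transcript t = history response route t.
Proof.
elim: t => [|t IH] //=; rewrite IH /history -(addn1 t.+1) iotaD map_cat cats1 /=.
by rewrite IH.
Qed.

Lemma drop_succ t : (t < size l)%N ->
  exists b, drop (size l - t.+1) l = b :: drop (size l - t) l.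
Proof.
move=> tl; exists (nth true l (size l - t.+1)).
by rewrite (drop_nth true) ?subnSK //; lia.
Qed.

Lemma transcript_record t : (t <= size l)%N ->
  transcript t = record (drop (size l - t) l).
Proof.
elim: t => [|t IH] tl; first by rewrite /= route_runner // subn0 drop_size.
have [b E] := drop_succ tl.
by rewrite /= (route_runner tl) IH ?(ltnW tl) // E.
Qed.

Lemma response_chasers t : (t <= size l)%N ->
  response t = chasers (drop (size l - t) l).
Proof.
case: t => [|t] tl; first by rewrite subn0 drop_size.
by have [b ->] := drop_succ tl; rewrite /= transcript_record // ltnW.
Qed.

Lemma response_follows : follows sigma p response route.
Proof. by split=> // t; rewrite -transcriptE. Qed.

Lemma response_step t i : (linf_dist (response t i) (response t.+1 i) <= 1)%N.
Proof.
have [h E] : exists h, transcript t = rcons h (response t, route t).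
  by case: t => [|t]; [exists [::] | exists (transcript t)].
by rewrite /= E; exact: (legal h (response t, route t)).
Qed.

Hypothesis in_field : forall t, 0 <= row (drop t l) <= n'%:Z.

Lemma route_path : robber_path C route.
Proof.
split; first by rewrite /=; lia.
  by rewrite /= subn0 drop_size /row /= inordK; lia.
move=> t; rewrite /linf_dist geq_max; apply/andP; split; first by rewrite /=; lia.
have [tl|lt] := ltnP t (size l); last first.
  by rewrite /route (_ : size l - t.+1 = size l - t)%N ?subrr //; lia.
rewrite !runner_row //.
by have [b ->] := drop_succ tl; rewrite /row; case: b => /=; lia.
Qed.

Hypothesis l_clear : clear gap_x gap_y l.
Hypothesis behind : forall i, gap_x i l <= -2.

Lemma route_free : ~ captured response route.
Proof.
have late t i : (size l <= t)%N -> (response t i).1 <= (route t).1 - 2.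
  move/subnK <-; elim: (t - size l)%N => [|d IH].
    rewrite add0n response_chasers // subnn drop0.
    by have := behind i; rewrite /gap_x /=; lia.
  have := response_step (d + size l) i; rewrite /linf_dist geq_max => /andP[st _].
  by rewrite addSn; move: st IH => /=; lia.
move=> [t [i hit]].
have close : (linf_dist (response t i) (route t) <= 1)%N.
  by case: hit => <-; [rewrite /linf_dist !subrr | exact: response_step].
move: close; rewrite /linf_dist geq_max => /andP[cx cy].
have [tl|lt] := leqP t (size l); last by have := late t i (ltnW lt); lia.
have /setP/(_ i) := clear_drop (size l - t) l_clear; rewrite !inE.
move: cx cy; rewrite response_chasers // route_runner // runner_row //.
rewrite /near /ahead /gap_y /gap_x.
by lia.
Qed.

Lemma route_wins : robber_wins response route.
Proof.
split; last exact: route_free.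
by move=> k k0; exists (`|C| + k)%N; rewrite /=; lia.
Qed.

End Play.
End Pursuit.

(** * The lower bound *)

(** The robber first goes to the middle of the strip, far away from the cops,
    and then roams until all of them are behind him. *)
Lemma not_cops_win j n m : (m < 2 ^ j)%N -> (40 * 1024 ^ j <= n)%N -> ~ cops_win n m.
Proof.
move=> mj nj [p [sigma [legal win]]].
have S0 : (0 < 1024 ^ j)%N by rewrite expn_gt0.
case: n => [|n'] in nj p sigma legal win *; first by lia.
pose n := n'.+1.
(* The robber may start as far left as he likes: with this C every cop is at
   least 200 * n columns ahead. *)
pose M := (\sum_i `|(p i).1|)%N.
have pM i : (`|(p i).1| <= M)%N by rewrite /M (bigD1 i) //= leq_addr.
pose C : int := (200 * n + M)%N%:Z.
pose l0 := nseq (n %/ 4) false.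
have dl0 q : disp true (nseq q false) = - (2 * q)%N%:Z by elim: q => //= q ->; lia.
have start i : (200 * n)%N%:Z <= gap_x p sigma C i [::] <= (400 * n + 2 * M)%N%:Z.
  by rewrite /gap_x /=; have := pM i; lia.
have xs := gap_x_step p C legal; have ys := gap_y_step p C legal.
have far q r : (q <= n %/ 4)%N -> (r <= 100 * n)%N ->
    crowd (gap_x p sigma C) (gap_y p sigma C) r (nseq q false) = set0.
  move=> qn rn; apply/setP=> i; rewrite !inE /near; apply/negP => /and3P[_ rx _].
  have := dx_cat xs i (nseq q false) [::]; rewrite cats0 size_nseq.
  by have := start i; lia.
have cl0 : clear (gap_x p sigma C) (gap_y p sigma C) l0.
  suff walk q : (q <= n %/ 4)%N -> clear (gap_x p sigma C) (gap_y p sigma C) (nseq q false).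
    exact: walk.
  elim: q => [|q IH] qn /=; first by rewrite (far 0%N) ?eqxx.
  by rewrite (far q.+1) // eqxx IH // ltnW.
have gl0 : good (gap_x p sigma C) (gap_y p sigma C) j l0.
  move=> i ij; rewrite far ?cards0 ?expn_gt0 //.
  have : (1024 ^ i <= 1024 ^ j)%N by rewrite leq_exp2l // ltnW.
  by rewrite /n; lia.
have [] := roam xs ys (400 * n + 2 * M + 2) _ gl0 cl0; first by rewrite card_ord.
move=> k [long cl band].
pose l := k ++ l0.
have in_field t : 0 <= row n' (drop t l) <= n'%:Z.
  rewrite /row /l drop_cat; case: ifP => _.
    by rewrite disp_cat dl0; have := band t; rewrite /n; lia.
  by rewrite drop_nseq dl0; rewrite /n; lia.
have behind i : gap_x p sigma C i l <= -2.
  have := dx_cat xs i l [::]; rewrite cats0 size_cat.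
  by have := start i; lia.
apply: (win C (response p sigma C l) (route n' C l)).
- by move=> i; have := pM i; rewrite /C /n; lia.
- exact: route_path.
- exact: response_follows.
- exact: route_wins.
Qed.

Lemma cop_number_lower j n : (40 * 1024 ^ j <= n)%N -> (2 ^ j <= cop_number n)%N.
Proof.
move=> nj; rewrite /cop_number; case: ex_minnP => m /asboolP win _.
by rewrite leqNgt; apply/negP => mj; exact: (not_cops_win mj nj win).
Qed.

Theorem theorem3p3 (R : realType) :
  exists (c : R) (n0 : nat),
    0 < c /\
    forall n : nat, (0 < n)%N -> (n0 <= n)%N ->
      c * (n%:R `^ (3%:R / 100%:R)) <= (cop_number n)%:R.
Proof.
(* With 1024 ^ j.+1 <= n < 1024 ^ j.+2 there are at least 2 ^ j cops, and
   n ^ (3 / 100) <= n ^ (1 / 10) <= 2 ^ j.+2. *)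
exists 4^-1, 1024%N; split=> [|n n0 n1024]; first by rewrite invr_gt0.
have /andP[lo hi] := trunc_log_bounds (isT : (1 < 1024)%N) n0.
have [j E] : exists j, trunc_log 1024 n = j.+1.
  by case: trunc_log hi => [|j] hi; [move: hi; rewrite expn1; lia | exists j].
rewrite E in lo hi.
have low : (2 ^ j <= cop_number n)%N by apply: cop_number_lower; rewrite expnS in lo; lia.
rewrite ler_pdivrMl //; apply: (@le_trans _ _ (2 ^ j.+2)%N%:R); last first.
  by rewrite -natrM ler_nat !expnS; lia.
have n1 : (1 : R) <= n%:R by rewrite ler1n.
apply: (@le_trans _ _ (n%:R `^ 10%:R^-1)).
  by rewrite ler_powR // ler_pdivrMr // mulrC ler_pdivlMr // -!natrM ler_nat.
apply: (@le_trans _ _ ((1024 ^ j.+2)%N%:R `^ 10%:R^-1)).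
  by rewrite ge0_ler_powR ?nnegrE ?invr_ge0 ?ler0n // ler_nat ltnW.
have -> : (1024 ^ j.+2 = (2 ^ j.+2) ^ 10)%N by rewrite -expnM mulnC expnM.
by rewrite natrX -powR_mulrn ?ler0n // -powRrM mulfV ?powRr1 ?ler0n ?pnatr_eq0.
Qed.
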